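(* Let $\epsilon_X,\delta_X$ and $\epsilon_\alpha,\delta_\alpha$ be privacy parameters, and let $x\in\mathbb R^d$ be a query. Suppose that the mechanism releasing $\mathsf K(x,\widetilde X)$ is $(\epsilon_X,\delta_X)$-DP and that the mechanism releasing $(\widetilde K+\lambda I_n)^{-1}$ is $(\epsilon_\alpha,\delta_\alpha)$-DP. Let $\epsilon=\epsilon_X+\epsilon_\alpha$ and $\delta=\delta_X+\delta_\alpha$. Then the private NTK regression, which outputs $f^*_{\widetilde K}(x)=\frac1n\mathsf K(x,\widetilde X)^\top(\widetilde K+\lambda I_n)^{-1}Y$, is $(\epsilon,\delta)$-DP.
   Context: Dataset: $\mathcal D=\{(x_i,y_i)\}_{i=1}^n=(X,Y)$, $x_i\in\mathbb R^d$, $\|x_i\|_2\le B$, $y_i\in\{-1,1\}$. $\beta$-close neighboring datasets $\mathcal D,\mathcal D'$ differ only in one data point, say the $n$-th, where $(x_n,y_n)$ is replaced by $(x_n',y_n)$ with $\|x_n-x_n'\|_2\le\beta$; in particular the label vector $Y$ is the same for both (only $X$ is sensitive). A randomized algorithm $\mathcal A$ is $(\epsilon,\delta)$-DP if for all neighboring datasets $\mathcal D,\mathcal D'$ and all measurable $S$, $\Pr[\mathcal A(\mathcal D)\in S]\le e^\epsilon\Pr[\mathcal A(\mathcal D')\in S]+\delta$. Weights $w_1,\dots,w_m\in\mathbb R^d$ are drawn from $\mathcal N(0,\sigma^2I_d)$ and then held fixed. $\mathsf K(x,z)=\frac1m\sum_{r=1}^m\langle\langle w_r,x\rangle x,\langle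 w_r,z\rangle z\rangle$; $K_{i,j}=\mathsf K(x_i,x_j)$; $\mathsf K(x,X)=(\mathsf K(x,x_i))_{i\in[n]}$; $\lambda>0$. $\widetilde K=\frac1k\sum_{i=1}^kg_ig_i^\top$ with $g_1,\dots,g_k\sim\mathcal N(0,K)$ i.i.d. $\widetilde X=X+Z$ where $Z\in\mathbb R^{n\times d}$ has independent truncated Laplace entries $\mathrm{TLap}(\Delta_X,\epsilon_X,\delta_X)$, $\Delta_X=\sqrt d\,\beta$: density proportional to $e^{-|z|\epsilon_X/\Delta_X}$ on $[-B_L,B_L]$, $B_L=(\Delta_X/\epsilon_X)\log(1+\frac{e^{\epsilon_X}-1}{2\delta_X})$. The randomness used for $\widetilde K$ and $\widetilde X$ is independent. *)

(* Defs.v *)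
From HB Require Import structures.
From mathcomp Require Import all_boot all_order all_algebra.
From mathcomp Require Import all_classical all_reals all_analysis.

Set Implicit Arguments.
Unset Strict Implicit.
Unset Printing Implicit Defensive.

Import Order.TTheory GRing.Theory Num.Theory.
Import numFieldNormedType.Exports.

Local Open Scope classical_set_scope.
Local Open Scope ring_scope.

(* The library has no sigma-algebra on matrices: 'M[T]_(m, n) gets the one
   generated by the entries, as the library does for n.-tuple T.  For T := R it
   is the Borel sigma-algebra of R^(m x n). *)
Definition measure_matrix_display : measure_display -> measure_display.
Proof. exact. Qed.

Definition matrix_measurable {d} {T : measurableType d} (m n : nat) :
    set (set 'M[T]_(m, n)) :=
  <<s \bigcup_(ij in [set: 'I_m * 'I_n])
        preimage_set_system setT (fun A : 'M[T]_(m, n) => A ij.1 ij.2)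
          measurable >>.

Section measurable_matrix.
Context {d} {T : measurableType d}.
Variables m n : nat.

Let matrix_set0 : @matrix_measurable d T m n set0.
Proof. exact: sigma_algebra0. Qed.

Let matrix_setC A :
  @matrix_measurable d T m n A -> @matrix_measurable d T m n (~` A).
Proof. exact: sigma_algebraC. Qed.

Let matrix_bigcup (F : (set 'M[T]_(m, n))^nat) :
  (forall i, matrix_measurable (F i)) -> matrix_measurable (\bigcup_i F i).
Proof. exact: sigma_algebra_bigcup. Qed.

HB.instance Definition _ := @isMeasurable.Build (measure_matrix_display d)
  'M[T]_(m, n) (@matrix_measurable d T m n)
  matrix_set0 matrix_setC matrix_bigcup.

End measurable_matrix.

Section euclidean.
Context {R : realType}.

Definition dotp {d : nat} (u v : 'cV[R]_d) : R := \sum_i u i 0 * v i 0.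

(* The library's norm on matrices is the sup norm. *)
Definition l2norm {d : nat} (u : 'cV[R]_d) : R := Num.sqrt (dotp u u).

Definition point {n d : nat} (X : 'M[R]_(n, d)) (i : 'I_n) : 'cV[R]_d :=
  (row i X)^T.

End euclidean.

Section probability_notions.
Context {d : measure_display} {T : measurableType d} {R : realType}.
Variable P : probability T R.
Local Open Scope ereal_scope.

Definition has_law {d'} {T' : measurableType d'} (X : T -> T')
    (mu : set T' -> \bar R) :=
  forall A, measurable A -> P (X @^-1` A) = mu A.

Definition independent {d1 d2} {T1 : measurableType d1}
    {T2 : measurableType d2} (X : T -> T1) (Y : T -> T2) :=
  forall A B, measurable A -> measurable B ->
    P (X @^-1` A `&` Y @^-1` B) = P (X @^-1` A) * P (Y @^-1` B).

Definition mutually_independent {I : finType} {d'} {T' : measurableType d'}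
    (X : I -> T -> T') :=
  forall (J : {set I}) (B : I -> set T'), (forall i, measurable (B i)) ->
    P (\bigcap_(i in [set` J]) (X i @^-1` B i)) =
    \prod_(i in J) P (X i @^-1` B i).

(* normal_prob m 0 is not the Dirac mass at m (it is uniform on [0, 1]). *)
Definition normal_law (m s : R) : set R -> \bar R :=
  fun A => if (s == 0)%R then dirac m A else normal_prob m s A.

(* N(0, Sigma), where Sigma may be singular: every linear functional u of the
   vector is N(0, u^T Sigma u). *)
Definition centered_gaussian {n : nat} (g : T -> 'cV[R]_n) (Sigma : 'M[R]_n) :=
  forall u : 'cV[R]_n,
    has_law (fun t => dotp u (g t))
      (normal_law 0 (Num.sqrt (dotp u (Sigma *m u)))).

End probability_notions.

Section truncated_laplace.
Context {R : realType}.
Variables Delta eps delta : R.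

Definition tlap_bound : R :=
  (Delta / eps) * ln (1 + (expR eps - 1) / (2 * delta)).

Definition tlap_fun : R -> R :=
  (fun z => expR (- (`|z| * eps / Delta))) \_ `[- tlap_bound, tlap_bound].

Definition tlap_pdf (z : R) : R :=
  tlap_fun z / fine (\int[lebesgue_measure]_t (tlap_fun t)%:E)%E.

Definition tlap (A : set R) : \bar R :=
  (\int[lebesgue_measure]_(z in A) (tlap_pdf z)%:E)%E.

End truncated_laplace.

Section differential_privacy.
Context {R : realType}.

Record dataset (n d : nat) (B : R) := Dataset {
  inputs : 'M[R]_(n, d);
  labels : 'cV[R]_n;
  inputs_bound : forall i, l2norm (point inputs i) <= B;
  labels_sign : forall i, labels i 0 = -1 \/ labels i 0 = 1
}.

Definition close_neighbors {n d : nat} {B : R} (beta : R)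
    (D D' : dataset n d B) : Prop :=
  labels D = labels D' /\
  exists i : 'I_n,
    l2norm (point (inputs D) i - point (inputs D') i) <= beta /\
    forall j, j != i -> point (inputs D) j = point (inputs D') j.

(* A randomized algorithm is given by its random outputs A D, on the probability
   space of its internal randomness. *)
Definition dp {dT dO : measure_display} {T : measurableType dT}
    {O : measurableType dO} (P : probability T R) {data : Type}
    (neighbors : data -> data -> Prop) (eps delta : R)
    (A : data -> T -> O) : Prop :=
  (forall D, measurable_fun setT (A D)) /\
  forall D D', neighbors D D' -> forall S, measurable S ->
    (P (A D @^-1` S) <= (expR eps)%:E * P (A D' @^-1` S) + delta%:E)%E.

End differential_privacy.

Section ntk.
Context {R : realType} {n d m : nat}.
Variable w : 'I_m -> 'cV[R]_d.

Definition ntk (x z : 'cV[R]_d) : R :=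
  m%:R^-1 * \sum_r dotp (dotp (w r) x *: x) (dotp (w r) z *: z).

Definition ntk_matrix (X : 'M[R]_(n, d)) : 'M[R]_n :=
  \matrix_(i, j) ntk (point X i) (point X j).

Definition ntk_vec (x : 'cV[R]_d) (X : 'M[R]_(n, d)) : 'cV[R]_n :=
  \col_i ntk x (point X i).

End ntk.

Definition gaussian_sampling {R : realType} {n k : nat}
    (g : k.-tuple 'cV[R]_n) : 'M[R]_n :=
  k%:R^-1 *: \sum_i (tnth g i *m (tnth g i)^T).

Definition reg_inverse {R : realType} {n : nat} (lambda : R) (K : 'M[R]_n) :
    'M[R]_n :=
  invmx (K + lambda%:M).

(* The prediction from the test vector v, the regularized inverse M and the
   labels Y. *)
Definition ntk_regression {R : realType} {n : nat} (v : 'cV[R]_n)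
    (M : 'M[R]_n) (Y : 'cV[R]_n) : R :=
  n%:R^-1 * (v^T *m M *m Y) 0 0.

(* Main.v *)
(* The test vector is a function of Z and the regularized inverse a function of
   the Gaussian samples, so the two releases are independent and the probability
   of an event S for the pair is the average of the probabilities of the sections
   of S.  Bounding each section by the second guarantee, truncating at 1, and then
   averaging the resulting [0, 1]-valued function with the first guarantee adds up
   the privacy parameters.  The prediction is a measurable function of the pair
   and of the labels, which neighboring datasets share. *)
Require Import Defs.
From HB Require Import structures.
From mathcomp Require Import all_boot all_order all_algebra.
From mathcomp Require Import all_classical all_reals all_analysis.
From mathcomp Require Import measurable_realfun.

Set Implicit Arguments.
Unset Strict Implicit.
Unset Printing Implicit Defensive.

Import Order.TTheory GRing.Theory Num.Theory.
Import numFieldNormedType.Exports.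

Local Open Scope classical_set_scope.
Local Open Scope ring_scope.

(** * Composition and post-processing of privacy guarantees for independent mechanisms *)

Section dp_composition.
Context {R : realType} {dT : measure_display} {T : measurableType dT}.
Variable P : probability T R.
Context {d1 d2 : measure_display}.
Context {O1 : measurableType d1} {O2 : measurableType d2}.
Local Open Scope ereal_scope.

(* Layer cake: [E h = \int_0^oo P(h > r) dr], and only the levels [r <= 1]
   contribute, so the additive error [delta] is integrated over a set of
   length 1. *)
Lemma dp_integral (c delta : R) (U V : T -> O1) (h : O1 -> R) :
    (0 <= c)%R -> (0 <= delta)%R ->
    measurable_fun setT U -> measurable_fun setT V ->
    measurable_fun setT h -> (forall y, (0 <= h y <= 1)%R) ->
    (forall S, measurable S ->
       P (U @^-1` S) <= c%:E * P (V @^-1` S) + delta%:E) ->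
  \int[P]_t (h (U t))%:E <= c%:E * \int[P]_t (h (V t))%:E + delta%:E.
Proof.
move=> c0 delta0 mU mV mh h01 UV.
have mhU : measurable_fun setT (h \o U) by exact: measurableT_comp.
have mhV : measurable_fun setT (h \o V) by exact: measurableT_comp.
pose X : {RV P >-> R} := mfun_Sub (mem_set mhU).
pose Y : {RV P >-> R} := mfun_Sub (mem_set mhV).
have h0 y : (0 <= h y)%R by case/andP: (h01 y).
have -> : \int[P]_t (h (U t))%:E =
    \int[lebesgue_measure]_(r in `[0%R, +oo[) ccdf X r.
  rewrite -[RHS](ge0_expectation_ccdf (X := X)) ?expectation.unlock//.
  by move=> t; exact: h0.
have -> : \int[P]_t (h (V t))%:E =
    \int[lebesgue_measure]_(r in `[0%R, +oo[) ccdf Y r.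
  rewrite -[RHS](ge0_expectation_ccdf (X := Y)) ?expectation.unlock//.
  by move=> t; exact: h0.
pose I : set R := `[0%R, +oo[%classic.
pose J : set R := `[0%R, 1%R]%classic.
have mI : measurable I by exact: measurable_itv.
have mJ : measurable J by exact: measurable_itv.
have m1J : measurable_fun I (fun r => (\1_J r : R)%:E).
  by apply/measurable_EFinP; exact: measurable_indic.
have mX : measurable_fun I (ccdf X).
  by apply: measurable_funTS; exact: ccdf_measurable.
have mY : measurable_fun I (ccdf Y).
  by apply: measurable_funTS; exact: ccdf_measurable.
have mdJ : measurable_fun I (fun r => delta%:E * (\1_J r : R)%:E).
  exact: emeasurable_funM.
(* Writing [delta] as an integral over [I] turns the claim into a pointwise comparison of integrands
   in the level [r]. *)
have <- : \int[lebesgue_measure]_(r in I)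
    (delta%:E * (\1_J r : R)%:E) = delta%:E.
  rewrite ge0_integralZl//.
  rewrite integral_indic// setIidl; last first.
    by move=> r; rewrite /I /J /= !in_itv/= andbT => /andP[].
  by rewrite /J/= lebesgue_measure_itv/= lte_fin ltr01 oppr0 adde0 mule1.
have cY0 r : 0 <= c%:E * ccdf Y r by rewrite mule_ge0// lee_fin.
have mcY : measurable_fun I (fun r => c%:E * ccdf Y r).
  exact: emeasurable_funM.
have J0 r : 0 <= delta%:E * (\1_J r : R)%:E.
  by rewrite mule_ge0// lee_fin.
rewrite -ge0_integralZl// -ge0_integralD//.
apply: ge0_le_integral => //.
  exact: emeasurable_funD.
move=> r; rewrite /I /= in_itv/= andbT => r0.
(* Up to level 1 the assumed bound applies to the superlevel set of [h]; beyond it that set is empty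
   because [h] is at most 1. *)
have [r1|r1] := leP r 1%R.
  rewrite indicE mem_set/=; last by rewrite /J /= in_itv/= r0.
  rewrite mule1.
  have := UV (h @^-1` `]r, +oo[); apply.
  by rewrite -[X in measurable X]setTI; exact: mh.
have -> : ccdf X r = 0.
  rewrite /ccdf /distribution /pushforward [X in P X](_ : _ = set0) ?measure0//.
  apply/seteqP; split => t //=; rewrite in_itv/= andbT => rh.
  by case/andP: (h01 (U t)) => _; rewrite leNgt (lt_trans r1 rh).
exact: adde_ge0.
Qed.

(** Independence says that the joint law agrees with the product of the marginals on rectangles.
    This determines the joint law, and the product measure of [S] is by definition the integral of
    the measures of its sections. *)
Lemma independent_joint (U : T -> O1) (V : T -> O2) (S : set (O1 * O2)) :
    measurable_fun setT U -> measurable_fun setT V -> independent P U V ->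
    measurable S ->
  P ((fun t => (U t, V t)) @^-1` S) =
  \int[P]_t P (V @^-1` xsection S (U t)).
Proof.
move=> mU mV UV mS.
pose X : {RV P >-> O1} := mfun_Sub (mem_set mU).
pose Y : {RV P >-> O2} := mfun_Sub (mem_set mV).
have mXY : measurable_fun setT (fun t => (U t, V t)).
  exact: measurable_fun_pair.
pose XY : {RV P >-> (O1 * O2)%type} := mfun_Sub (mem_set mXY).
rewrite -[LHS]/(distribution P XY S).
rewrite -(@product_measure_unique _ _ _ _ _ (distribution P X)
  (distribution P Y))//.
rewrite /product_measure1 ge0_integral_distribution//.
exact: (measurable_fun_xsection (distribution P Y)).
Qed.

Lemma dp_pair {data : Type} (neighbors : data -> data -> Prop)
    (eps1 delta1 eps2 delta2 : R) (A1 : data -> T -> O1) (A2 : data -> T -> O2) :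
    (0 <= delta1)%R -> (0 <= delta2)%R ->
    dp P neighbors eps1 delta1 A1 -> dp P neighbors eps2 delta2 A2 ->
    (forall D, independent P (A1 D) (A2 D)) ->
  dp P neighbors (eps1 + eps2) (delta1 + delta2) (fun D t => (A1 D t, A2 D t)).
Proof.
move=> delta1_ge0 delta2_ge0 [mA1 dp1] [mA2 dp2] indep.
split=> [D|D D' DD' S mS]; first exact: measurable_fun_pair.
rewrite !independent_joint//.
(* The probability that the second output completes a first output [y] to an element of [S]. *)
pose q D y := P (A2 D @^-1` xsection S y).
have mxS y : measurable (xsection S y) by exact: measurable_xsection.
have mA2S E y : measurable (A2 E @^-1` xsection S y).
  by rewrite -[X in measurable X]setTI; exact: mA2.
have qfin E y : q E y \is a fin_num by exact: fin_num_measure.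
have mq E : measurable_fun setT (q E).
  pose Y : {RV P >-> O2} := mfun_Sub (mem_set (mA2 E)).
  exact: (measurable_fun_xsection (distribution P Y)).
have mqU E F : measurable_fun setT (fun t => q E (A1 F t)).
  exact: measurableT_comp.
(* Truncating at 1 first makes delta2 enter without the factor e^eps1. *)
pose h y := Num.min 1%R (expR eps2 * fine (q D' y))%R.
have mh : measurable_fun setT h.
  apply: measurable_minr => //; apply: measurable_funM => //.
  by apply: measurableT_comp => //; exact: fine_measurable.
have h01 y : (0 <= h y <= 1)%R.
  rewrite /h le_min ler01/= ge_min lexx/= andbT.
  by rewrite mulr_ge0 ?expR_ge0// fine_ge0.
have q_le y : q D y <= (h y)%:E + delta2%:E.
  rewrite -EFinD /h addr_minl EFin_min le_min; apply/andP; split.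
    rewrite (le_trans (probability_le1 _ _))// lee_fin lerDl//.
  by rewrite EFinD EFinM fineK//; exact: dp2.
have mhA E : measurable_fun setT (fun t => (h (A1 E t))%:E).
  by apply/measurable_EFinP; exact: measurableT_comp.
have hA0 E t : 0 <= (h (A1 E t))%:E.
  by rewrite lee_fin; case/andP: (h01 (A1 E t)).
(* Integrated against the probability [P], the constant [delta2] stays [delta2]. What is left is the
   mean of [h] at the first output, which [dp_integral] transfers from [D] to [D']. *)
apply: (@le_trans _ _ (\int[P]_t ((h (A1 D t))%:E + delta2%:E))).
  apply: ge0_le_integral => //.
  - exact: mqU.
  - exact: emeasurable_funD.
  - by move=> t _; exact: q_le.
rewrite ge0_integralD//.
rewrite integral_cst//= probability_setT mule1 EFinD addeA leeD2r//.
apply: le_trans (dp_integral (expR_ge0 eps1) delta1_ge0 (mA1 D) (mA1 D') mh h01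
  (fun S mS => dp1 _ _ DD' S mS)) _.
(* On the side of [D'] the truncation is dropped: [h] is at most [expR eps2] times [q D'], which
   supplies the second exponential factor. *)
rewrite leeD2r// expRD EFinM -muleA lee_pmul2l// ?lte_fin ?expR_gt0//.
rewrite -ge0_integralZl//; last exact: mqU.
apply: ge0_le_integral => //.
- by apply: emeasurable_funM => //; exact: mqU.
- by move=> t _; rewrite -[X in _ * X](fineK (qfin D' (A1 D' t))) -EFinM lee_fin ge_min lexx orbT.
Qed.

(** The map [f] may read the dataset, as long as it cannot distinguish neighbors; this leaves room
    for public data such as the labels. The event [S] is pulled back along the common map. *)
Lemma dp_postprocess {data : Type} (neighbors : data -> data -> Prop)
    (eps delta : R) (A : data -> T -> O1) (f : data -> O1 -> O2) :
    (forall D, measurable_fun setT (f D)) ->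
    (forall D D', neighbors D D' -> f D = f D') ->
    dp P neighbors eps delta A ->
  dp P neighbors eps delta (fun D t => f D (A D t)).
Proof.
move=> mf ff [mA dpA]; split=> [D|D D' DD' S mS]; first exact: measurableT_comp.
rewrite -(ff _ _ DD'); apply: (dpA _ _ DD' (f D @^-1` S)).
by rewrite -[X in measurable X]setTI; exact: mf.
Qed.

Lemma independent_comp {d3 d4 : measure_display} {O3 : measurableType d3}
    {O4 : measurableType d4} (U : T -> O1) (V : T -> O2) (f : O1 -> O3)
    (g : O2 -> O4) :
    measurable_fun setT f -> measurable_fun setT g -> independent P U V ->
  independent P (f \o U) (g \o V).
Proof.
move=> mf mg UV A B mA mB; apply: (UV (f @^-1` A) (g @^-1` B)).
- by rewrite -[X in measurable X]setTI; exact: mf.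
- by rewrite -[X in measurable X]setTI; exact: mg.
Qed.

Lemma independent_sym (U : T -> O1) (V : T -> O2) :
  independent P U V -> independent P V U.
Proof. by move=> UV A B mA mB; rewrite setIC UV// muleC. Qed.

End dp_composition.

(** * Measurability of matrix operations, inversion included *)

Section matrix_measurability.
Context {R : realType}.

Lemma measurable_entry {d : measure_display} {T : measurableType d} {m n : nat}
    (i : 'I_m) (j : 'I_n) :
  measurable_fun setT (fun A : 'M[T]_(m, n) => A i j).
Proof.
move=> _ S mS; apply: sub_sigma_algebra; exists (i, j) => //=.
by exists S.
Qed.

(** Preimages need only be checked on a generating family, here the events on single entries. *)
Lemma measurable_matrix {d d' : measure_display} {T : measurableType d}
    {T' : measurableType d'} {m n : nat} (f : T' -> 'M[T]_(m, n)) :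
  (forall i j, measurable_fun setT (fun t => f t i j)) -> measurable_fun setT f.
Proof.
move=> mf; pose G := \bigcup_(ij in [set: 'I_m * 'I_n])
  preimage_set_system setT (fun A : 'M[T]_(m, n) => A ij.1 ij.2) measurable.
apply: (@measurability _ _ _ _ _ _ G) => //.
move=> _ [_ [[i j] _ [S mS <-]] <-].
by rewrite !setTI; have := mf i j measurableT S mS; rewrite setTI.
Qed.

Lemma measurable_invr : measurable_fun setT (@GRing.inv R).
Proof.
(* The convention that 0 has inverse 0 isolates the only discontinuity; on the open set of nonzero
   reals inversion is continuous. *)
have -> : @GRing.inv R = (fun x => if x == 0 then 0 else x^-1).
  by apply/funext => x; case: eqVneq => // ->; rewrite invr0.
have mz : measurable_fun setT (fun x : R => x == 0) by exact: measurable_fun_eqr.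
apply: measurable_fun_if => //; rewrite setTI.
have -> : (fun x : R => x == 0) @^-1` [set false] = [set x | x != 0].
  by apply/seteqP; split=> x /=; [move=> ->|move/negbTE].
apply: open_continuous_measurable_fun; first exact: open_neq.
by apply/in_setP => x /= x0; exact: inv_continuous.
Qed.

Context {d : measure_display} {T : measurableType d}.

Lemma measurable_mulmx {m n p : nat} (A : T -> 'M[R]_(m, n))
    (B : T -> 'M[R]_(n, p)) :
    measurable_fun setT A -> measurable_fun setT B ->
  measurable_fun setT (fun t => A t *m B t).
Proof.
move=> mA mB; apply: measurable_matrix => i j.
under eq_fun do rewrite mxE.
apply: measurable_sum => k; apply: measurable_funM.
- exact: (measurableT_comp (measurable_entry i k) mA).
- exact: (measurableT_comp (measurable_entry k j) mB).
Qed.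

Lemma measurable_trmx {m n : nat} (A : T -> 'M[R]_(m, n)) :
  measurable_fun setT A -> measurable_fun setT (fun t => (A t)^T).
Proof.
move=> mA; apply: measurable_matrix => i j.
under eq_fun do rewrite mxE.
exact: (measurableT_comp (measurable_entry j i) mA).
Qed.

Lemma measurable_addmx {m n : nat} (A B : T -> 'M[R]_(m, n)) :
    measurable_fun setT A -> measurable_fun setT B ->
  measurable_fun setT (fun t => A t + B t).
Proof.
move=> mA mB; apply: measurable_matrix => i j.
under eq_fun do rewrite mxE.
apply: measurable_funD.
- exact: (measurableT_comp (measurable_entry i j) mA).
- exact: (measurableT_comp (measurable_entry i j) mB).
Qed.

Lemma measurable_scalemx {m n : nat} (a : T -> R) (A : T -> 'M[R]_(m, n)) :
    measurable_fun setT a -> measurable_fun setT A ->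
  measurable_fun setT (fun t => a t *: A t).
Proof.
move=> ma mA; apply: measurable_matrix => i j.
under eq_fun do rewrite mxE.
apply: measurable_funM => //.
exact: (measurableT_comp (measurable_entry i j) mA).
Qed.

Lemma measurable_summx {I : Type} (s : seq I) {m n : nat}
    (A : I -> T -> 'M[R]_(m, n)) :
    (forall i, measurable_fun setT (A i)) ->
  measurable_fun setT (fun t => \sum_(i <- s) A i t).
Proof.
move=> mA; apply: measurable_matrix => i j.
under eq_fun do rewrite summxE.
by apply: measurable_sum => k; exact: (measurableT_comp (measurable_entry i j)).
Qed.

Lemma measurable_det {n : nat} (A : T -> 'M[R]_n) :
    (forall i j, measurable_fun setT (fun t => A t i j)) ->
  measurable_fun setT (fun t => \det (A t)).
Proof.
move=> mA; rewrite /determinant; apply: measurable_sum => s.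
apply: measurable_funM => //.
by apply: measurable_prod => i _.
Qed.

(** Cramer's rule: off the zero set of the determinant, the inverse is the adjugate over the
    determinant, and cofactors are polynomials in the entries. On singular matrices [invmx] returns
    its argument. *)
Lemma measurable_invmx {n : nat} (A : T -> 'M[R]_n) :
  measurable_fun setT A -> measurable_fun setT (fun t => invmx (A t)).
Proof.
move=> mA.
have mAij i j : measurable_fun setT (fun t => A t i j).
  exact: (measurableT_comp (measurable_entry i j) mA).
have mdet := measurable_det mAij.
have -> : (fun t => invmx (A t)) =
    (fun t => if \det (A t) == 0 then A t else (\det (A t))^-1 *: \adj (A t)).
  by apply/funext => t; rewrite /invmx unitmxE unitfE; case: eqVneq.
apply: measurable_fun_ifT => //; first exact: measurable_fun_eqr.
apply: measurable_scalemx; first exact: measurableT_comp measurable_invr mdet.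
apply: measurable_matrix => i j; under eq_fun do rewrite mxE /cofactor.
apply: measurable_funM => //; apply: measurable_det => k l.
under eq_fun do rewrite !mxE.
exact: mAij.
Qed.

End matrix_measurability.

(** * Measurability of the test vector, the regularized inverse and the prediction *)

Section ntk_measurability.
Context {R : realType} {n d m k : nat}.

Lemma measurable_ntk_vec {d'} {T : measurableType d'} (w : 'I_m -> 'cV[R]_d)
    (x : 'cV[R]_d) (X : T -> 'M[R]_(n, d)) :
  measurable_fun setT X -> measurable_fun setT (fun t => ntk_vec w x (X t)).
Proof.
move=> mX; apply: measurable_matrix => i j.
under eq_fun do rewrite mxE.
have mpoint l : measurable_fun setT (fun t => Defs.point (X t) i l 0).
  under eq_fun do rewrite !mxE.
  exact: (measurableT_comp (measurable_entry i l) mX).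
have mdot u : measurable_fun setT (fun t => dotp u (Defs.point (X t) i)).
  by apply: measurable_sum => l; apply: measurable_funM.
apply: measurable_funM => //; apply: measurable_sum => r.
apply: measurable_sum => l; apply: measurable_funM => //.
under eq_fun do rewrite mxE.
exact: measurable_funM.
Qed.

Lemma measurable_reg_inverse_gaussian (lambda : R) :
  measurable_fun setT
    (fun g : k.-tuple 'cV[R]_n => reg_inverse lambda (gaussian_sampling g)).
Proof.
apply: measurable_invmx; apply: measurable_addmx => //.
apply: measurable_scalemx => //; apply: measurable_summx => i.
have mi : measurable_fun setT (fun g : k.-tuple 'cV[R]_n => tnth g i).
  exact: measurable_tnth.
apply: measurable_mulmx => //; exact: measurable_trmx.
Qed.

Lemma measurable_ntk_regression (Y : 'cV[R]_n) :
  measurable_fun setT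
    (fun vM : 'cV[R]_n * 'M[R]_n => ntk_regression vM.1 vM.2 Y).
Proof.
apply: measurable_funM => //.
have m2 : measurable_fun setT
    (fun vM : 'cV[R]_n * 'M[R]_n => vM.1^T *m vM.2 *m Y).
  apply: measurable_mulmx => //; apply: measurable_mulmx => //.
  exact: measurable_trmx.
exact: (measurableT_comp (measurable_entry 0 0) m2).
Qed.

End ntk_measurability.

Theorem lemmaI1 (R : realType) (n d m k : nat)
    (n_gt0 : (0 < n)%N) (d_gt0 : (0 < d)%N) (m_gt0 : (0 < m)%N)
    (k_gt0 : (0 < k)%N)
    (B beta sigma lambda : R)
    (beta_gt0 : 0 < beta) (sigma_gt0 : 0 < sigma) (lambda_gt0 : 0 < lambda)
    (epsX deltaX epsA deltaA : R)
    (epsX_gt0 : 0 < epsX) (deltaX_gt0 : 0 < deltaX)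
    (epsA_ge0 : 0 <= epsA) (deltaA_ge0 : 0 <= deltaA)
    (* the weights, drawn once and then held fixed at w *)
    (dW : measure_display) (TW : measurableType dW) (PW : probability TW R)
    (W : 'I_m -> {RV PW >-> 'cV[R]_d})
    (W_law : forall r, centered_gaussian PW (W r) ((sigma ^+ 2)%:M))
    (W_indep : mutually_independent PW (fun r => W r : TW -> 'cV[R]_d))
    (omegaW : TW) (w : 'I_m -> 'cV[R]_d) (w_def : forall r, w r = W r omegaW)
    (* the randomness of the mechanisms *)
    (dT : measure_display) (T : measurableType dT) (P : probability T R)
    (g : dataset n d B -> {RV P >-> k.-tuple 'cV[R]_n})
    (g_law : forall D i,
       centered_gaussian P (fun t => tnth (g D t) i) (ntk_matrix w (inputs D)))
    (g_indep : forall D,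
       mutually_independent P (fun (i : 'I_k) t => tnth (g D t) i))
    (Z : {RV P >-> 'M[R]_(n, d)})
    (Z_law : forall i j,
       has_law P (fun t => Z t i j)
         (tlap (Num.sqrt d%:R * beta) epsX deltaX))
    (Z_indep : mutually_independent P
       (fun (ij : 'I_n * 'I_d) t => Z t ij.1 ij.2))
    (gZ_indep : forall D, independent P (g D) Z)
    (x : 'cV[R]_d)
    (dp_X : dp P (close_neighbors beta) epsX deltaX
       (fun (D : dataset n d B) t => ntk_vec w x (inputs D + Z t)))
    (dp_A : dp P (close_neighbors beta) epsA deltaA
       (fun (D : dataset n d B) t =>
          reg_inverse lambda (gaussian_sampling (g D t)))) :
  dp P (close_neighbors beta) (epsX + epsA) (deltaX + deltaA)
    (fun (D : dataset n d B) t =>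
       ntk_regression (ntk_vec w x (inputs D + Z t))
         (reg_inverse lambda (gaussian_sampling (g D t))) (labels D)).
Proof.
have mX D : measurable_fun setT
    (fun z : 'M[R]_(n, d) => ntk_vec w x (inputs (D : dataset n d B) + z)).
  by apply: measurable_ntk_vec; apply: measurable_addmx.
(* The prediction is a post-processing of the two releases taken as a pair; the labels enter only
   through [f], and neighbors share them. *)
apply: (dp_postprocess (A := fun D t => (_, _))
  (f := fun (D : dataset n d B) vM => ntk_regression vM.1 vM.2 (labels D))).
- by move=> D; exact: measurable_ntk_regression.
- by move=> D D' [-> _].
apply: dp_pair => //; first exact: ltW.
(* For a fixed dataset the test vector depends only on [Z] and the inverse only on [g D], so
   independence passes from the noise to the releases. *)
move=> D; apply: independent_comp (mX D)
  (measurable_reg_inverse_gaussian lambda) (independent_sym (gZ_indep D)).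
Qed.
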